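(* Let $A$ be a totally positive $d\times N$ matrix ($d\le N$) whose last row is $(1,\dots,1)$ (so that $A$ is flat). Then the sequence of coefficients of the polynomial $f_A$ is box-positive. In particular, it is trapezoidal.
   Context: A real matrix is totally positive if all its minors (of all sizes) are positive. **Definition of $f_A$.** Let $A$ be a real $d\times N$ matrix of rank $d$ with columns $a_1,\dots,a_N$. $A$ is flat if there is a linear form $h$ with $h(a_i)=1$ for all $i$. Bases are the $d$-subsets $B\subset[N]$ with $\{a_i\}_{i\in B}$ linearly independent; circuits are the inclusion-minimal $C\subset[N]$ with $\{a_i\}_{i\in C}$ linearly dependent. For a circuit $C$ there is a dependence $\sum_{i\in C}\lambda_ia_i=0$, all $\lambda_i\neq0$, unique up to nonzero scalar; setting $\lambda_i=0$ for $i\notin C$ gives $\lambda_C\in\mathbb{R}^N$. $\rho\in\mathbb{R}^N$ is generic if $(\lambda_C,\rho)\neq0$ for all circuits $C$; fix such a $\rho$, scale so that $(\lambda_C,\rho)>0$, and put $C^+=\{i\in C:\lambda_i>0\}$. For a base $B$, $\mathrm{ext}_\rho(B)$ is the number of $j\in[N]\setminus B$ with $j\in C^+$ for the unique circuit $C\subset B\cup\{j\}$. For flat $A$, $f_A(q)=\sum_Bq^{\mathrm{ext}_\rho(B)}|\det(a_i)_{i\in B}|$, summed over all bases; this is known not to depend on the generic $\rho$. **Box-positivity.** $[m]_q=1+q+\cdots+q^{m-1}$. A polynomial $f(q)$ of degree $D$ is $d$-box-positive if it is a linear combination with positive coefficients of products $[m_1]_q[m_2]_q\cdots[m_d]_q$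 with $m_1,\dots,m_d\in\mathbb{Z}_{>0}$ and $m_1+\cdots+m_d=D+d$. The polynomial (or its coefficient sequence) is box-positive if it is $d$-box-positive for some $d$. **Trapezoidal.** The coefficients $a_0,\dots,a_n$ of a polynomial of degree $n$ are trapezoidal if $a_0<a_1<\cdots<a_k=\cdots=a_m>a_{m+1}>\cdots>a_n$ for some $0\le k\le m\le n$. *)

(* Defs.v *)
From mathcomp Require Import all_boot all_order all_algebra.
From mathcomp Require Import boolp reals.

Set Implicit Arguments.
Unset Strict Implicit.
Unset Printing Implicit Defensive.

Import Order.TTheory GRing.Theory Num.Theory.
Local Open Scope ring_scope.

Definition totally_positive (R : realType) (d N : nat) (A : 'M[R]_(d, N)) : Prop :=
  forall (k : nat) (f : 'I_k -> 'I_d) (g : 'I_k -> 'I_N),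
    {homo f : i j / (i < j)%N} -> {homo g : i j / (i < j)%N} ->
    0 < \det (mxsub f g A).

Definition indep_cols (R : realType) (d N : nat) (A : 'M[R]_(d, N))
    (S : {set 'I_N}) : bool :=
  free [seq col j A | j <- enum S].

Definition is_base (R : realType) (d N : nat) (A : 'M[R]_(d, N))
    (B : {set 'I_N}) : bool :=
  (#|B| == d) && indep_cols A B.

Definition is_circuit (R : realType) (d N : nat) (A : 'M[R]_(d, N))
    (C : {set 'I_N}) : bool :=
  minset (fun S : {set 'I_N} => ~~ indep_cols A S) C.

Definition pairing (R : realType) (N : nat) (u v : 'cV[R]_N) : R :=
  \sum_(i < N) u i 0 * v i 0.

(* For a circuit C, such a vector lam exists and is unique up to a nonzero
   scalar; it is lambda_C. *)
Definition circuit_vector (R : realType) (d N : nat) (A : 'M[R]_(d, N))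
    (C : {set 'I_N}) (lam : 'cV[R]_N) : Prop :=
  (forall i, (lam i 0 != 0) = (i \in C)) /\ A *m lam = 0.

Definition generic (R : realType) (d N : nat) (A : 'M[R]_(d, N))
    (rho : 'cV[R]_N) : Prop :=
  forall (C : {set 'I_N}) (lam : 'cV[R]_N),
    is_circuit A C -> circuit_vector A C lam -> pairing lam rho != 0.

(* The set C^+. For generic rho the normalization 0 < pairing lam rho
   determines lam up to a positive scalar, so the signs of its entries do not
   depend on the witness. *)
Definition circuit_plus (R : realType) (d N : nat) (A : 'M[R]_(d, N))
    (rho : 'cV[R]_N) (C : {set 'I_N}) : {set 'I_N} :=
  [set i in C | `[< exists lam : 'cV[R]_N,
    [/\ circuit_vector A C lam, 0 < pairing lam rho & 0 < lam i 0] >]].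

(* For a base B and j outside B, exactly one circuit is contained in j |: B. *)
Definition ext_activity (R : realType) (d N : nat) (A : 'M[R]_(d, N))
    (rho : 'cV[R]_N) (B : {set 'I_N}) : nat :=
  #|[set j in ~: B | [exists C : {set 'I_N},
      [&& is_circuit A C, C \subset j |: B & j \in circuit_plus A rho C]]]|.

(* The columns indexed by B, in increasing order of index; meaningful when
   #|B| = d. *)
Definition base_mx (R : realType) (d N : nat) (A : 'M[R]_(d, N))
    (B : {set 'I_N}) : 'M[R]_d :=
  \matrix_(i, k) [seq A i j | j <- enum B]`_k.

Definition f_poly (R : realType) (d N : nat) (A : 'M[R]_(d, N))
    (rho : 'cV[R]_N) : {poly R} :=
  \sum_(B : {set 'I_N} | is_base A B)
    `|\det (base_mx A B)| *: 'X^(ext_activity A rho B).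

Definition qint (R : realType) (m : nat) : {poly R} := \sum_(i < m) 'X^i.

Definition d_box_positive (R : realType) (d : nat) (f : {poly R}) : Prop :=
  exists (D : nat) (s : seq (R * d.-tuple nat)),
    [/\ size f = D.+1,
        forall t, t \in s ->
          [/\ 0 < t.1, forall i : 'I_d, (0 < tnth t.2 i)%N
            & (\sum_(i < d) tnth t.2 i)%N = (D + d)%N]
      & f = \sum_(t <- s) t.1 *: \prod_(i < d) qint R (tnth t.2 i)].

Definition box_positive (R : realType) (f : {poly R}) : Prop :=
  exists d : nat, d_box_positive d f.

Definition trapezoidal (R : realType) (f : {poly R}) : Prop :=
  exists n k m : nat,
    [/\ size f = n.+1, (k <= m <= n)%N,
        forall i, (i < k)%N -> f`_i < f`_i.+1,
        forall i, (k <= i < m)%N -> f`_i = f`_i.+1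
      & forall i, (m <= i < n)%N -> f`_i.+1 < f`_i].

(* Main.v *)
Require Import Defs.
From mathcomp Require Import all_boot all_order all_algebra.
From mathcomp Require Import boolp reals.
From mathcomp Require Import zify.

(* Let r = d + 1.  Subtracting consecutive columns turns det A_B, for an r-set B,
   into the sum of the d-minors det A'_g of the difference matrix A' over all
   d-sets g interlacing B.  Exchanging sums, the coefficient of det A'_g in f_A is
   the sum of q^ext(B) over the transversals B of the partition of [N] into the r
   intervals I_i cut off by g.
   The number ext(B) counts the lifted columns (a_j, rho_j) strictly above the
   hyperplane through the lifted columns of B.  Counting them interval by interval
   maps transversals to the box of all t with 0 <= t_i < |I_i|.  The map is
   injective: if B and B' have the same counts, the difference h of their linear
   forms vanishes at a nonnegative combination p_i of the columns in each I_i, and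
   the p_i are linearly independent because all maximal minors of A are positive,
   so h = 0.  Being an injection between sets of equal size, it is a bijection,
   and the coefficient is the product of the [|I_i|]_q.
   The minors det A'_g are positive by Fekete's criterion, since the minors of A'
   on contiguous columns are minors of A. *)

Set Implicit Arguments.
Unset Strict Implicit.
Unset Printing Implicit Defensive.

Import Order.TTheory GRing.Theory Num.Theory.
Local Open Scope ring_scope.

(** * Strictly increasing maps of ordinals *)

Definition incr r N (f : 'I_r -> 'I_N) :=
  [forall i : 'I_r, forall j : 'I_r, (i < j)%N ==> (f i < f j)%N].

Lemma incrP r N (f : 'I_r -> 'I_N) : reflect {homo f : i j / (i < j)%N} (incr f).
Proof.
apply: (iffP forallP) => [fi i j|fi i]; first by apply/implyP; apply: (forallP (fi i)).
by apply/forallP => j; apply/implyP; apply: fi.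
Qed.

Lemma incr_inj r N (f : 'I_r -> 'I_N) : {homo f : i j / (i < j)%N} -> injective f.
Proof.
move=> fi i j fij; have [/fi|/fi|/val_inj//] := ltngtP i j.
  by rewrite fij ltnn.
by rewrite fij ltnn.
Qed.

Lemma card_incr r N (f : 'I_r -> 'I_N) :
  {homo f : i j / (i < j)%N} -> #|f @: setT| = r.
Proof. by move=> fi; rewrite card_imset ?cardsT ?card_ord//; exact: incr_inj. Qed.

Lemma incr_leq r N (f : 'I_r -> 'I_N) :
  {homo f : i j / (i < j)%N} -> {homo f : i j / (i <= j)%N}.
Proof. by move=> fi i j; rewrite leq_eqVlt => /orP[/eqP/val_inj->//|/fi/ltnW]. Qed.

(** * Determinants, column differences and interlacing *)

Lemma det_mulmx_ffun (R : comPzRingType) n N (M : 'M[R]_(n, N)) (W : 'M_(N, n)) :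
  \det (M *m W) =
  \sum_(f : {ffun 'I_n -> 'I_N}) (\prod_j W (f j) j) * \det (colsub f M).
Proof.
rewrite -det_tr {1}/determinant.
under eq_bigr => s _.
  under eq_bigr => j _ do rewrite !mxE.
  rewrite bigA_distr_bigA big_distrr /=.
  over.
rewrite exchange_big /=; apply: eq_bigr => f _.
rewrite -det_tr /determinant big_distrr; apply: eq_bigr => s _ /=.
rewrite mulrCA -big_split /=; congr (_ * _).
by apply: eq_bigr => j _; rewrite !mxE mulrC.
Qed.

Lemma det_scale_cols (R : comPzRingType) n (M : 'M[R]_n) (v : 'I_n -> R) :
  \det (\matrix_(i, j) (M i j * v j)) = \det M * \prod_j v j.
Proof.
have -> : \matrix_(i, j) (M i j * v j) = M *m diag_mx (\row_j v j).
  apply/matrixP => i j; rewrite !mxE (bigD1 j) //= !mxE eqxx mulr1n big1 ?addr0//.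
  by move=> k kj; rewrite !mxE (negPf kj) mulr0n mulr0.
rewrite det_mulmx det_diag; congr (_ * _).
by apply: eq_bigr => j _; rewrite mxE.
Qed.

(** Earlier column minus later one, last row dropped; this order spares [det_diffcol] a sign. *)
Definition diffcol (R : pzRingType) d n (M : 'M[R]_(d.+1, n.+1)) : 'M_(d, n) :=
  \matrix_(i, j) (M (lift ord_max i) (lift ord_max j)
                  - M (lift ord_max i) (lift ord0 j)).

(** The unitriangular [U] subtracts from each column but the last its right neighbour; the last row
    becomes (0, ..., 0, 1), and expanding along it leaves [diffcol M]. *)
Lemma det_diffcol (R : comPzRingType) d (M : 'M[R]_d.+1) :
  (forall j, M ord_max j = 1) -> \det M = \det (diffcol M).
Proof.
move=> M1.
pose U : 'M[R]_d.+1 :=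
  \matrix_(k, j) ((k == j)%:R - ((k : nat) == j.+1)%:R).
have detU : \det U = 1.
  rewrite det_trig => [|]; last first.
    apply/is_trig_mxP => i j ij; rewrite mxE -val_eqE /=.
    by rewrite (_ : (i == j :> nat) = false) 1?(_ : (i == j.+1 :> nat) = false)
      ?subrr //; lia.
  by apply: big1 => i _; rewrite mxE eqxx (_ : (_ == _ :> nat) = false) ?subr0//; lia.
have MUE i (j : 'I_d) :
    (M *m U) i (lift ord_max j) = M i (lift ord_max j) - M i (lift ord0 j).
  rewrite mxE; under eq_bigr do rewrite mxE mulrBr.
  rewrite sumrB (bigD1 (lift ord_max j)) //= eqxx mulr1 big1 ?addr0; last first.
    by move=> k /negPf ->; rewrite mulr0.
  rewrite (bigD1 (lift ord0 j)) //= big1 ?addr0 => [|k kj]; last first.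
    rewrite (_ : (_ == _ :> nat) = false) ?mulr0//; move: kj.
    by rewrite -val_eqE /= /bump; have := ltn_ord j; lia.
  by rewrite (_ : (_ == _ :> nat) = true) ?mulr1//= /bump; have := ltn_ord j; lia.
have MUmax i : (M *m U) i ord_max = M i ord_max.
  rewrite mxE (bigD1 ord_max) //= mxE eqxx big1 ?addr0.
    by rewrite (_ : (_ == _ :> nat) = false) ?subr0 ?mulr1//=; lia.
  move=> k km; rewrite mxE (negPf km) (_ : (_ == _ :> nat) = false) ?subrr ?mulr0//=.
  by have := ltn_ord k; lia.
rewrite -[LHS]mulr1 -detU -det_mulmx (expand_det_row _ ord_max).
rewrite (bigD1 ord_max) //= MUmax M1 mul1r big1 ?addr0 => [|j]; last first.
  by case: (unliftP ord_max j) => [k ->|-> /eqP//] _; rewrite MUE !M1 subrr mul0r.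
rewrite /cofactor addnn -signr_odd odd_double mul1r; congr (\det _).
by apply/matrixP => i j; rewrite !mxE -MUE mxE.
Qed.

Lemma incr_gap d n (f : 'I_d.+1 -> 'I_n) :
  {homo f : i j / (i < j)%N} -> forall j : 'I_d, (f (lift ord_max j) < f (lift ord0 j))%N.
Proof. by move=> fi j; apply: fi; rewrite /= /bump; have := ltn_ord j; lia. Qed.

(** A difference of two columns of [A] telescopes into the columns of [diffcol A] between them. So
    [diffcol (colsub f A)] is [diffcol A] times a 0/1 matrix [W], whose weight products are the
    interlacing indicators. *)
Lemma det_colsub_interlace (R : comPzRingType) d n (A : 'M[R]_(d.+1, n.+1))
    (f : 'I_d.+1 -> 'I_n.+1) :
  (forall j, A ord_max j = 1) -> {homo f : i j / (i < j)%N} ->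
  \det (colsub f A) =
  \sum_(g : {ffun 'I_d -> 'I_n} |
      [forall c, (f (lift ord_max c) <= g c < f (lift ord0 c))%N])
    \det (colsub g (diffcol A)).
Proof.
move=> A1 fi; rewrite det_diffcol => [|j]; last by rewrite mxE A1.
pose W : 'M[R]_(n, d) :=
  \matrix_(k, c) (f (lift ord_max c) <= k < f (lift ord0 c))%:R.
have -> : diffcol (colsub f A) = diffcol A *m W.
  apply/matrixP => i j; rewrite !mxE.
  pose a k : R := - A (lift ord_max i) (inord k).
  transitivity (\sum_(f (lift ord_max j) <= k < f (lift ord0 j)) (a k.+1 - a k)).
    rewrite telescope_sumr; last by apply: ltnW; apply: incr_gap.
    by rewrite /a !inord_val opprK addrC.
  rewrite (big_nat_widen _ _ n); last first.
    by have := ltn_ord (f (lift ord0 j)); lia.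
  rewrite (big_nat_widenl _ 0)// big_mkord big_mkcond /=.
  apply: eq_bigr => k _; rewrite !mxE /a andbC.
  case: ifP => _; rewrite ?mulr0 ?mulr1 // opprK addrC; congr (A _ _ - A _ _).
    by apply/val_inj; rewrite /= inordK /bump; have := ltn_ord k; lia.
  by apply/val_inj; rewrite /= inordK /bump; have := ltn_ord k; lia.
rewrite det_mulmx_ffun [RHS]big_mkcond; apply: eq_bigr => g _.
case: forallP => [gP|/forallP]; last first.
  rewrite negb_forall => /existsP[c /negPf cP].
  by rewrite (bigD1 c) //= mxE cP !mul0r.
by rewrite big1 ?mul1r// => c _; rewrite mxE gP.
Qed.

Lemma incr_interlace d n (f : 'I_d.+1 -> 'I_n.+1) (g : 'I_d -> 'I_n) :
  {homo f : i j / (i < j)%N} ->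
  [forall c : 'I_d, f (lift ord_max c) <= g c < f (lift ord0 c)]%N ->
  {homo g : i j / (i < j)%N}.
Proof.
move=> fi /forallP fg i j ij.
have /andP[_ h1] := fg i; have /andP[h2 _] := fg j.
apply: leq_trans h1 _; apply: leq_trans h2; apply: incr_leq => //.
by rewrite lift_max lift0.
Qed.

(** * Fekete's criterion *)

(** The condition on [c], stated without truncated subtraction, makes [c i - i] constant: the
    columns are consecutive, while the rows are arbitrary. *)
Definition solid_pos (R : numFieldType) d n (M : 'M[R]_(d, n)) :=
  forall s (p : 'I_s -> 'I_d) (c : 'I_s -> 'I_n),
    {homo p : i j / (i < j)%N} -> (forall i j : 'I_s, (c i + j = c j + i)%N) ->
    0 < \det (mxsub p c M).

Lemma solid_pos_diffcol (R : numFieldType) d n (A : 'M[R]_(d.+1, n.+1)) :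
  (forall j, A ord_max j = 1) -> solid_pos A -> solid_pos (diffcol A).
Proof.
move=> A1 Apos [|s] p c pincr csolid; first by rewrite det_mx00.
have cE i : (c i = c ord0 + i :> nat)%N.
  by have /= := csolid i ord0; rewrite addn0.
have cmax : (c ord0 + s < n)%N by rewrite -(cE ord_max).
(* Undoing [det_diffcol]: [p'] appends the last row to [p], and [c'] appends to [c] the next
   column. *)
pose p' (i : 'I_s.+2) : 'I_d.+1 := oapp (lift ord_max \o p) ord_max (unlift ord_max i).
pose c' (j : 'I_s.+2) : 'I_n.+1 := inord (c ord0 + j).
have p'l i : p' (lift ord_max i) = lift ord_max (p i) by rewrite /p' liftK.
have p'm : p' ord_max = ord_max by rewrite /p' unlift_none.
have c'E j : (c' j = c ord0 + j :> nat)%N.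
  by rewrite /c' inordK//; have := ltn_ord j; lia.
have -> : mxsub p c (diffcol A) = diffcol (mxsub p' c' A).
  apply/matrixP => i j; rewrite !mxE p'l; congr (A _ _ - A _ _); apply/val_inj.
    by rewrite /= c'E cE /= /bump; have := ltn_ord j; have := ltn_ord (c j); rewrite cE; lia.
  by rewrite /= c'E cE /= /bump; lia.
rewrite -det_diffcol => [|j]; last by rewrite mxE p'm A1.
apply: Apos => [i j|i j]; last by rewrite !c'E; lia.
case: (unliftP ord_max i) => [i' ->|->]; last by have := ltn_ord j; rewrite /=; lia.
case: (unliftP ord_max j) => [j' ->|->]; last first.
  by rewrite p'l p'm /= /bump => _; have := ltn_ord (p i'); lia.
by rewrite !p'l !lift_max; apply: pincr.
Qed.

Lemma solid_pos_scale (R : numFieldType) d n (A : 'M[R]_(d, n)) (v : 'I_n -> R) :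
  (forall j, 0 < v j) -> solid_pos A -> solid_pos (\matrix_(i, j) (A i j * v j)).
Proof.
move=> v0 Apos s p c pincr csolid.
have -> : mxsub p c (\matrix_(i, j) (A i j * v j)) =
    \matrix_(i, j) (mxsub p c A i j * v (c j)).
  by apply/matrixP => i j; rewrite !mxE.
by rewrite det_scale_cols mulr_gt0 ?prodr_gt0 ?Apos.
Qed.

(* Fekete's criterion, by induction on d: rescale the columns so that the last row
   becomes 1, then pass to column differences, which have one row less. *)
Lemma solid_pos_det (R : numFieldType) d n (A : 'M[R]_(d, n)) (f : 'I_d -> 'I_n) :
  solid_pos A -> {homo f : i j / (i < j)%N} -> 0 < \det (colsub f A).
Proof.
elim: d n A f => [|d IHd] n A f Apos fincr; first by rewrite det_mx00.
case: n => [|n] in A f Apos fincr *; first by case: (f ord0).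
have last0 j : 0 < A ord_max j.
  have := Apos 1%N (fun=> ord_max) (fun=> j).
  rewrite det_mx11 mxE; apply=> // i k; rewrite ?(ord1 i) ?(ord1 k)//.
pose A1 := \matrix_(i, j) (A i j * (A ord_max j)^-1).
have A1last j : A1 ord_max j = 1 by rewrite mxE divff ?gt_eqF.
have A1pos : solid_pos A1 by apply: solid_pos_scale => // j; rewrite invr_gt0.
have -> : colsub f A = \matrix_(i, j) (colsub f A1 i j * A ord_max (f j)).
  by apply/matrixP => i j; rewrite !mxE mulfVK ?gt_eqF.
rewrite det_scale_cols mulr_gt0 ?prodr_gt0// det_colsub_interlace//.
have A'pos := solid_pos_diffcol A1last A1pos.
have gt0 (g : {ffun 'I_d -> 'I_n}) :
    [forall c, f (lift ord_max c) <= g c < f (lift ord0 c)]%N ->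
    0 < \det (colsub g (diffcol A1)).
  by move=> gP; apply: IHd => //; apply: incr_interlace gP.
have gap := incr_gap fincr.
have fn c : (f (lift ord_max c) < n)%N.
  by have := gap c; have := ltn_ord (f (lift ord0 c)); lia.
(* One interlacing map exists, so the sum of positive minors is nonempty and hence positive. *)
pose g0 := [ffun c => Ordinal (fn c)].
have g0P : [forall c, f (lift ord_max c) <= g0 c < f (lift ord0 c)]%N.
  by apply/forallP => c; rewrite ffunE /= leqnn gap.
by rewrite (bigD1 g0)//= ltr_pwDl ?gt0 ?sumr_ge0// => g /andP[/gt0/ltW].
Qed.

(** * Sets of indices enumerated in increasing order *)

Lemma sorted_enum_ord N (S : {set 'I_N}) : sorted ltn [seq val i | i <- enum S].
Proof.
have lt_tr : transitive (relpre (@nat_of_ord N) ltn) by move=> y x z; apply: ltn_trans.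
have eS : enum S = [seq i <- enum 'I_N | i \in S] by rewrite enumT.
rewrite sorted_map eS; apply: (sorted_filter lt_tr).
by rewrite -sorted_map val_enum_ord iota_ltn_sorted.
Qed.

Lemma enum_val_incr N (S : {set 'I_N}) :
  {homo (fun k : 'I_#|S| => enum_val k) : i j / (i < j)%N}.
Proof.
move=> i j ij; pose x0 := enum_default i.
rewrite !(enum_val_nth x0) -!(nth_map _ 0%N val) -?cardE//.
by apply: (sorted_ltn_nth ltn_trans) => //; rewrite ?inE ?size_map -?cardE ?sorted_enum_ord.
Qed.

(** * Bases, circuits and external activity for a totally positive matrix *)

Section TotallyPositive.
Variables (R : realType) (r N : nat) (A : 'M[R]_(r, N)).
Hypothesis Atp : totally_positive A.

Lemma tp_colsub_unit (f : 'I_r -> 'I_N) :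
  {homo f : i j / (i < j)%N} -> colsub f A \in unitmx.
Proof.
move=> fi; rewrite unitmxE unitfE gt_eqF//.
exact: (Atp (f := id) (fun _ _ => id) fi).
Qed.

(** The minor on the first [#|S|] rows and the columns in [S] is positive, so already these rows
    exclude a dependence. *)
Lemma tp_indep (S : {set 'I_N}) : (#|S| <= r)%N -> indep_cols A S.
Proof.
move=> Sr; have eX : [seq col j A | j <- enum S] =
  map_tuple (fun j => col j A) (enum_tuple (mem S)) by [].
rewrite /indep_cols eX; apply/freeP => k k0 i.
pose P := mxsub (widen_ord Sr) (fun j : 'I_#|S| => enum_val j) A.
have Pu : P \in unitmx.
  rewrite unitmxE unitfE gt_eqF//; apply: Atp => //.
  exact: enum_val_incr.
have : P *m \col_j k j = 0.
  apply/colP => l; move: k0 => /matrixP/(_ (widen_ord Sr l) 0).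
  rewrite summxE !mxE => k0; rewrite -[RHS]k0; apply: eq_bigr => j _.
  rewrite /= (nth_map (enum_default j)) -?cardE// -enum_val_nth.
  by rewrite !mxE mulrC.
move/(congr1 (mulmx (invmx P))); rewrite mulKmx// mulmx0 => /colP/(_ i).
by rewrite !mxE.
Qed.

Lemma dep_large (S : {set 'I_N}) : (r < #|S|)%N -> ~~ indep_cols A S.
Proof.
apply: contraTN => /eqP Sfree; rewrite -leqNgt cardE -(size_map (fun j => col j A)).
rewrite -Sfree (leq_trans (dimvS (subvf _)))// dimvf.
by rewrite dim_matrix mulr1.
Qed.

Lemma is_baseE (B : {set 'I_N}) : is_base A B = (#|B| == r).
Proof.
by rewrite /is_base; case: eqP => //= Br; rewrite tp_indep ?Br.
Qed.

Lemma tp_circuit (C : {set 'I_N}) : #|C| = r.+1 -> is_circuit A C.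
Proof.
move=> Cr; apply/minsetP; split; first by rewrite dep_large ?Cr.
move=> S Sdep SC; apply/eqP; rewrite eqEcard SC Cr ltnNge.
by apply: contra Sdep => /tp_indep.
Qed.

Lemma tp_kernel0 (S : {set 'I_N}) (lam : 'cV[R]_N) :
  (#|S| <= r)%N -> (forall i, i \notin S -> lam i 0 = 0) -> A *m lam = 0 -> lam = 0.
Proof.
move=> Sr lamS Alam; apply/colP => i; rewrite mxE.
case: (boolP (i \in S)) => [iS|/lamS//].
have := tp_indep Sr; rewrite /indep_cols.
have eX : [seq col j A | j <- enum S] =
  map_tuple (fun j => col j A) (enum_tuple (mem S)) by [].
rewrite eX => /freeP/(_ (fun k => lam (enum_val k) 0)) H.
rewrite -(enum_rankK_in iS iS); apply: H; rewrite -[RHS]Alam.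
transitivity (\sum_(j in S) lam j 0 *: col j A).
  rewrite [RHS]big_enum_val; apply: eq_bigr => j _.
  by rewrite /= (nth_map (enum_default j)) -?cardE// -enum_val_nth.
apply/colP => l; rewrite summxE [RHS]mxE [RHS](bigID (mem S)) /= [X in _ + X]big1.
  by rewrite addr0; apply: eq_bigr => j _; rewrite !mxE mulrC.
by move=> j /lamS ->; rewrite mulr0.
Qed.

Variable rho : 'cV[R]_N.
Implicit Type f : 'I_r -> 'I_N.

(* The linear form on R^r interpolating rho at the columns f k of A. *)
Definition interp f : 'rV[R]_r := (\row_k rho (f k) 0) *m invmx (colsub f A).

Definition height f j : R := rho j 0 - (interp f *m A) 0 j.

Lemma height0 f k : {homo f : i j / (i < j)%N} -> height f (f k) = 0.
Proof.
move=> fi; apply/eqP; rewrite subr_eq0 eq_sym; apply/eqP.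
transitivity ((interp f *m colsub f A) 0 k).
  rewrite [LHS]mxE [RHS]mxE; apply: eq_bigr => i _.
  by rewrite [colsub f A i k]mxE.
by rewrite mulmxKV ?tp_colsub_unit// mxE.
Qed.

(** Since [A *m lam = 0], subtracting a linear form of the columns from [rho] does not change the
    pairing; after subtracting [interp f] only the term at [j] survives. *)
Lemma pairing_height f j (lam : 'cV[R]_N) :
  {homo f : i j / (i < j)%N} -> j \notin f @: setT ->
  (forall i, i \notin j |: f @: setT -> lam i 0 = 0) -> A *m lam = 0 ->
  pairing lam rho = lam j 0 * height f j.
Proof.
move=> fi jf lam0 Alam.
have : (interp f *m A *m lam) 0 0 = 0 by rewrite -mulmxA Alam mulmx0 mxE.
rewrite mxE => H; rewrite -[LHS]subr0 -[X in _ - X]H -sumrB (bigD1 j)//= big1.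
  by rewrite addr0 /height mulrBr [X in _ - X]mulrC.
move=> i ij; have [|/lam0 ->] := boolP (i \in j |: f @: setT);
    last by rewrite mulr0 mul0r subrr.
rewrite in_setU1 (negPf ij) /= => /imsetP[k _ ->].
by rewrite [X in _ - X]mulrC -mulrBr [X in _ * X]height0 ?mulr0.
Qed.

(** Column [j] is expanded in the basis [f], with coefficients [c]. A vanishing entry would leave a
    nonzero dependence among only [r] columns. *)
Lemma tp_circuit_vector f j :
  {homo f : i j / (i < j)%N} -> j \notin f @: setT ->
  exists2 lam : 'cV[R]_N, circuit_vector A (j |: f @: setT) lam & lam j 0 = 1.
Proof.
move=> fi jf; pose c := invmx (colsub f A) *m col j A.
pose lam : 'cV[R]_N := \col_i ((i == j)%:R - \sum_k (f k == i)%:R * c k 0).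
have lamj : lam j 0 = 1.
  rewrite mxE eqxx big1 ?subr0// => k _.
  by case: eqP => [fkj|_]; rewrite ?mul0r//; rewrite -fkj imset_f in jf.
have lam0 i : i \notin j |: f @: setT -> lam i 0 = 0.
  rewrite in_setU1 negb_or => /andP[/negPf ij iNf]; rewrite mxE ij big1 ?subr0// => k _.
  by case: eqP => [fki|_]; rewrite ?mul0r//; rewrite -fki imset_f in iNf.
have Alam : A *m lam = 0.
  have cE : colsub f A *m c = col j A by rewrite mulKVmx ?tp_colsub_unit.
  apply/colP => l; rewrite mxE; under eq_bigr do rewrite mxE mulrBr.
  rewrite sumrB (bigD1 j)//= eqxx mulr1 big1 ?addr0; last first.
    by move=> i /negPf ->; rewrite mulr0.
  move: cE => /colP/(_ l); rewrite !mxE => <-.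
  apply/eqP; rewrite subr_eq0; apply/eqP.
  under [RHS]eq_bigr do rewrite big_distrr /=.
  rewrite exchange_big /=; apply: eq_bigr => k _.
  rewrite (bigD1 (f k))//= eqxx mul1r mxE big1 ?addr0// => i.
  by rewrite eq_sym => /negPf ->; rewrite mul0r mulr0.
exists lam => //; split=> // i; apply/idP/idP.
  by apply: contra_neqT => /lam0.
move=> iC; apply/eqP => lami.
suff lamE : lam = 0 by move: lamj; rewrite lamE mxE => /esym/eqP; rewrite oner_eq0.
apply: (@tp_kernel0 ((j |: f @: setT) :\ i)) => //.
  by move: (cardsD1 i (j |: f @: setT)); rewrite iC cardsU1 jf card_incr// !add1n => -[<-].
move=> k; rewrite in_setD1 negb_and negbK => /orP[/eqP ->//|]; exact: lam0.
Qed.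

(** By [pairing_height], when the pairing is positive, [lam j 0] and [height f j] have the same
    sign. Columns of the base have height 0, so all [j] may be counted. *)
Lemma ext_activityE f : {homo f : i j / (i < j)%N} ->
  ext_activity A rho (f @: setT) = #|[set j | 0 < height f j]|.
Proof.
move=> fi; apply: eq_card => j; rewrite !inE.
have [jf|jf] /= := boolP (j \in f @: setT).
  by move: jf => /imsetP[k _ ->]; rewrite height0// ltxx.
have Cc : #|j |: f @: setT| = r.+1 by rewrite cardsU1 jf card_incr.
have [lam lamC lamj] := tp_circuit_vector fi jf.
have lamP : pairing lam rho = height f j.
  rewrite (@pairing_height f j)// ?lamj ?mul1r//; last by case: lamC.
  by move=> i iC; apply/eqP; rewrite -[_ == _]negbK lamC.1.
apply/existsP/idP => [[C /and3P[_ CB]]|hj].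
  rewrite inE => /andP[jC /asboolP[mu [muC mu0 muj]]].
  rewrite -(pmulr_rgt0 _ muj) -pairing_height//; last by case: muC.
  move=> i iC; apply/eqP; rewrite -[_ == _]negbK muC.1.
  by apply: contra iC; apply: (subsetP CB).
exists (j |: f @: setT); rewrite subxx tp_circuit//= inE in_setU1 eqxx /=.
by apply/asboolP; exists lam; rewrite lamP lamj.
Qed.

Lemma generic_height f j : generic A rho -> {homo f : i j / (i < j)%N} ->
  height f j = 0 -> j \in f @: setT.
Proof.
move=> gen fi hj; apply/negPn/negP => jf.
have Cc : #|j |: f @: setT| = r.+1 by rewrite cardsU1 jf card_incr.
have [lam lamC lamj] := tp_circuit_vector fi jf.
have /eqP[] := gen _ _ (tp_circuit Cc) lamC.
rewrite (@pairing_height f j)// ?hj ?mulr0//; last by case: lamC.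
by move=> i iC; apply/eqP; rewrite -[_ == _]negbK lamC.1.
Qed.

End TotallyPositive.

(** * Transversals of an ordered partition and the points above their hyperplanes *)

Section Sections.
Variables (R : realType) (r N : nat) (A : 'M[R]_(r, N)) (rho : 'cV[R]_N).
Hypothesis Atp : totally_positive A.
Hypothesis rhoP : generic A rho.
Variable lab : 'I_N -> 'I_r.
Hypothesis lab_homo : {homo lab : i j / (i <= j)%N}.

Definition is_section (f : 'I_r -> 'I_N) := [forall i, lab (f i) == i].

Lemma section_incr f : is_section f -> {homo f : i j / (i < j)%N}.
Proof.
move=> /forallP fs i j; rewrite !ltnNge; apply: contra => /lab_homo.
by rewrite (eqP (fs i)) (eqP (fs j)).
Qed.

(** The determinant of [A *m W] is a sum over sections of nonnegative weights times positive minors,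
    with a positive term where all the chosen weights are positive. So [A *m W] is invertible, while
    [h] annihilates it. *)
Lemma form_eq0 (h : 'rV[R]_r) :
  (forall i, exists w : 'cV[R]_N,
    [/\ forall j, 0 <= w j 0, forall j, lab j != i -> w j 0 = 0,
        exists j, 0 < w j 0 & h *m A *m w = 0]) -> h = 0.
Proof.
move=> /choice[w wP]; pose W : 'M[R]_(N, r) := \matrix_(j, i) w i j 0.
have hW : h *m (A *m W) = 0.
  rewrite mulmxA; apply/rowP => i; have [_ _ _ /matrixP/(_ 0 0)] := wP i.
  rewrite [_ 0 0]mxE [_ 0 0 in X in _ = X -> _]mxE => wi; rewrite [LHS]mxE [RHS]mxE -[RHS]wi.
  by apply: eq_bigr => j _; rewrite [W _ _]mxE.
suff AWu : A *m W \in unitmx by rewrite -[h](mulmxK AWu) hW mul0mx.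
rewrite unitmxE unitfE gt_eqF// det_mulmx_ffun.
have pos f : is_section f -> 0 < \det (colsub f A).
  by move=> /section_incr fi; apply: (Atp (f := id) (fun _ _ => id) fi).
have /choice[g gP] : forall i, exists j, 0 < w i j 0 by move=> i; case: (wP i).
have g_section : is_section [ffun i => g i].
  apply/forallP => i; rewrite ffunE; apply: contraTT (gP i) => gi.
  by have [_ -> //] := wP i; rewrite ltxx.
rewrite (bigD1 [ffun i => g i])//= ltr_pwDl//.
  by apply: mulr_gt0 (pos _ g_section); apply: prodr_gt0 => i _; rewrite mxE ffunE.
apply: sumr_ge0 => f _; have [fs|] := boolP (is_section f).
  by apply: mulr_ge0 (ltW (pos _ fs)); apply: prodr_ge0 => i _; rewrite mxE; case: (wP i).
rewrite negb_forall => /existsP[i fi].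
by rewrite (bigD1 i)//= mxE; have [_ -> //] := wP i; rewrite !mul0r.
Qed.

Definition above f i := #|[set j | (lab j == i) && (0 < height A rho f j)]|.

(** Otherwise every height in fibre [i] is larger for [f'] than for [f]; then [f'] has strictly more
    points above, since [f i] has height 0 for [f] and becomes positive for [f']. *)
Lemma above_le f f' i : is_section f -> is_section f' ->
  (above f' i <= above f i)%N ->
  exists2 u, lab u = i & (interp A rho f *m A) 0 u <= (interp A rho f' *m A) 0 u.
Proof.
move=> fs f's; apply: contraPP => /forall2NP nle; apply/negP; rewrite -ltnNge.
have lt u : lab u = i -> height A rho f u < height A rho f' u.
  move=> ui; rewrite ltrD2l ltrN2 ltNge; apply/negP.
  by have [] := nle u.
apply: proper_card; apply/properP; split.
  apply/subsetP => u; rewrite !inE => /andP[ui h0]; rewrite ui /=.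
  by apply: lt_trans h0 _; apply/lt/eqP.
have fi : lab (f i) = i by apply/eqP; apply: (forallP fs).
exists (f i); rewrite !inE fi eqxx /= ?height0 ?ltxx//; last exact: section_incr.
by rewrite -(height0 Atp rho i (section_incr fs)) lt.
Qed.

Lemma above_inj f f' : is_section f -> is_section f' -> above f =1 above f' -> f =1 f'.
Proof.
move=> fs f's eqa.
pose h := interp A rho f - interp A rho f'.
have hE j : (h *m A) 0 j = (interp A rho f *m A) 0 j - (interp A rho f' *m A) 0 j.
  by rewrite /h mulmxBl [LHS]mxE [X in _ + X]mxE.
have h0 : h = 0.
  apply: form_eq0 => i.
  have [u ui hu] : exists2 u, lab u = i & (h *m A) 0 u <= 0.
    have [|u ui le] := @above_le f f' i fs f's; first by rewrite eqa.
    by exists u; rewrite // hE subr_le0.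
  have [v vi hv] : exists2 v, lab v = i & 0 <= (h *m A) 0 v.
    have [|v vi le] := @above_le f' f i f's fs; first by rewrite eqa.
    by exists v; rewrite // hE subr_ge0.
  have hdelta j : (h *m A *m delta_mx j 0) = ((h *m A) 0 j)%:M :> 'M_1.
    by rewrite -colE; apply/matrixP => a b; rewrite !ord1 !mxE mulr1n.
  have [hu0|hu0] := eqVneq ((h *m A) 0 u) 0.
    exists (delta_mx u 0); split=> [j|j ji||].
    - by rewrite mxE ler0n.
    - by rewrite mxE; case: eqP => // ju; rewrite ju ui eqxx in ji.
    - by exists u; rewrite mxE !eqxx ltr01.
    - by rewrite hdelta hu0 raddf0.
  have hu' : (h *m A) 0 u < 0 by rewrite lt_neqAle hu0.
  (* The weights are the values of [h] crosswise, so that [h] cancels on [w]; they are nonnegative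
     because h(u) < 0 <= h(v). *)
  pose w := (h *m A) 0 v *: delta_mx u 0 - (h *m A) 0 u *: delta_mx v 0 : 'cV[R]_N.
  have wE j : w j 0 = (h *m A) 0 v * (j == u)%:R + - (h *m A) 0 u * (j == v)%:R.
    rewrite /w -scaleNr [LHS]mxE; congr (_ + _); rewrite [LHS]mxE; congr (_ * _);
      by rewrite mxE andbT.
  exists w; split=> [j|j ji||].
  - by rewrite wE addr_ge0// mulr_ge0// ?ler0n// oppr_ge0.
  - rewrite wE; have /negPf -> : j != u by apply: contra_neq ji => ->.
    have /negPf -> : j != v by apply: contra_neq ji => ->.
    by rewrite !mulr0 addr0.
  - exists v; rewrite wE eqxx mulr1; case: eqP => [vu|_].
      by move: hu' hv; rewrite vu leNgt => ->.
    by rewrite mulr0 add0r oppr_gt0.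
  - rewrite /w mulmxBr -!scalemxAr !hdelta !scale_scalar_mx mulrC subrr//.
(* With equal forms, [f i] lies on the hyperplane of [f']; by genericity it is some [f' k], and the
   labels force [k = i]. *)
move=> i.
have : height A rho f' (f i) = 0.
  rewrite -(height0 Atp rho i (section_incr fs)) /height; congr (_ - _).
  by apply/esym/eqP; rewrite -subr_eq0 -hE h0 mul0mx mxE.
move=> /(generic_height Atp rhoP (section_incr f's))/imsetP[k _ fk].
have : lab (f i) = lab (f' k) by rewrite fk.
by rewrite (eqP (forallP fs i)) (eqP (forallP f's k)) fk => ->.
Qed.

Definition fibre i := #|[set j | lab j == i]|.

Lemma above_lt f i : is_section f -> (above f i < fibre i)%N.
Proof.
move=> fs; apply: proper_card; apply/properP; split.
  by apply/subsetP => j; rewrite !inE => /andP[].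
have fi : lab (f i) = i by apply/eqP; apply: (forallP fs).
exists (f i); rewrite !inE fi eqxx//= height0 ?ltxx//; exact: section_incr.
Qed.

Lemma sum_above f : (\sum_i above f i)%N = #|[set j | 0 < height A rho f j]|.
Proof.
rewrite -sum1_card (partition_big lab predT)//=; apply: eq_bigr => i _.
by rewrite /above -sum1_card; apply: eq_bigl => j; rewrite !inE andbC.
Qed.

(* Sending a section f to the numbers of points of each fibre strictly above the
   hyperplane through the lifted points of f is injective, hence, by counting,
   onto: a discrete ham sandwich theorem for well-separated sets. *)
Lemma sum_sections :
  \sum_(f : {ffun 'I_r -> 'I_N} | is_section f)
    'X^#|[set j | 0 < height A rho f j]| = \prod_i qint R (fibre i).
Proof.
have fibre_lt i : (fibre i < N.+1)%N by rewrite ltnS -[leqRHS](card_ord N) max_card.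
pose S := [set f : {ffun 'I_r -> 'I_N} | is_section f].
pose T (f : {ffun 'I_r -> 'I_N}) : {ffun 'I_r -> 'I_N.+1} := [ffun i => inord (above f i)].
pose Q i : pred 'I_N.+1 := fun x => (x < fibre i)%N.
have TE (f : {ffun 'I_r -> 'I_N}) i : is_section f -> T f i = above f i :> nat.
  by move=> fs; rewrite ffunE inordK// (ltn_trans (above_lt i fs)).
have Tinj : {in S &, injective T}.
  move=> f f'; rewrite !inE => fs f's /ffunP eT; apply/ffunP; apply: above_inj => // i.
  by rewrite -!TE// eT.
have Tim : T @: S = [set t in family Q].
  apply/eqP; rewrite eqEcard; apply/andP; split.
    apply/subsetP => _ /imsetP[f fS ->]; move: fS; rewrite !inE => fs.
    by apply/familyP => i; rewrite unfold_in /Q TE// above_lt.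
  rewrite card_in_imset// cardsE.
  (* Sections and box points are both counted by the product of the fibre sizes, so the injection
     [T] is onto. *)
  have -> : #|S| = #|family (fun i => [pred j | lab j == i])|.
    by apply: eq_card => f; rewrite inE; apply/forallP/familyP => fs i; have := fs i.
  rewrite !card_family; apply: eq_leq; congr foldr; apply: eq_map => i.
  rewrite (eq_card (B := mem [set x : 'I_N.+1 | x < fibre i]%N));
    last by move=> x; rewrite inE.
  rewrite -sum1dep_card -(big_ord_widen _ (fun=> 1%N) (ltnW (fibre_lt i))).
  by rewrite sum1_card card_ord /fibre cardsE.
transitivity (\sum_(f in S) 'X^(\sum_i T f i) : {poly R}).
  apply: eq_big => [f|f fs]; rewrite ?inE//; congr 'X^_.
  by rewrite -(sum_above f); apply: eq_bigr => i _; rewrite TE.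
rewrite -(big_imset (fun t : {ffun 'I_r -> 'I_N.+1} => 'X^(\sum_i t i) : {poly R})
  Tinj) Tim /=.
(* Widening all ranges to ['I_N.+1] gives the factors a common index type, as distributing the
   product requires. *)
under [RHS]eq_bigr => i _ do
  rewrite /qint (big_ord_widen _ (fun x => 'X^x) (ltnW (fibre_lt i))).
rewrite bigA_distr_big_dep /=.
apply: eq_big => [t|t _]; rewrite ?inE//.
by rewrite prodrXr.
Qed.

End Sections.

(** * Symmetric trapezoidal polynomials and products of q-integers *)

Section SymTrap.
Variable R : realType.
Implicit Types (f g : {poly R}) (D k m : nat).

(* Only the left half is constrained; the right half is its mirror image. *)
Record symtrap D k f : Prop := SymTrap {
  symtrap_le : (k.*2 <= D)%N;
  symtrap_sym : forall i, (i <= D)%N -> f`_i = f`_(D - i);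
  symtrap_big : forall i, (D < i)%N -> f`_i = 0;
  symtrap_pos : 0 < f`_0;
  symtrap_step : forall i, (i.+1.*2 <= D)%N ->
    if (i < k)%N then is_true (f`_i < f`_i.+1) else f`_i = f`_i.+1 }.

(** With a common centre, a step of the sum is strict as soon as it is strict in one summand. *)
Lemma symtrapD D k l f g :
  symtrap D k f -> symtrap D l g -> symtrap D (maxn k l) (f + g).
Proof.
move=> [kD fs fb f0 fi] [lD gs gb g0 gi]; split=> [|i iD|i iD||i iD].
- by move: kD lD; rewrite -!muln2; lia.
- by rewrite !coefD fs// gs.
- by rewrite coefD fb// gb// addr0.
- by rewrite coefD addr_gt0.
rewrite !coefD leq_max; have := fi i iD; have := gi i iD.
case: ifP => il; case: ifP => ik /= a b.
- exact: ltrD.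
- by rewrite b ltrD2l.
- by rewrite a ltrD2r.
- by rewrite a b.
Qed.

Lemma symtrapZ D k f (c : R) : 0 < c -> symtrap D k f -> symtrap D k (c *: f).
Proof.
move=> c0 [kD fs fb f0 fi]; split=> // [i iD|i iD||i iD]; rewrite ?coefZ//.
- by rewrite fs.
- by rewrite fb ?mulr0.
- by rewrite mulr_gt0.
by have := fi i iD; case: ifP => _; [rewrite ltr_pM2l|move=> ->].
Qed.

Lemma symtrap1 : symtrap 0 0 (1 : {poly R}).
Proof. by split=> // [[|i]|[|i]|] //; rewrite coef1 ?ltr01. Qed.

Lemma coef_qint m i : (qint R m)`_i = (i < m)%:R.
Proof.
have -> : qint R m = \poly_(j < m) 1.
  by rewrite poly_def; apply: eq_bigr => j _; rewrite scale1r.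
by rewrite coef_poly; case: ltnP.
Qed.

(** The bound on [a + b] puts [a] farther from the centre than [b]; if [b] is in the right half, it
    is reflected to [D - b], still beyond [a]. *)
Lemma symtrap_lt D k f a b : symtrap D k f -> (a < b)%N -> (a + b < D)%N ->
  if (a < k)%N then is_true (f`_a < f`_b) else f`_a = f`_b.
Proof.
move=> fT; have [_ fs _ _ fi] := fT.
have left c : (a < c)%N -> (c.*2 <= D)%N ->
    if (a < k)%N then is_true (f`_a < f`_c) else f`_a = f`_c.
  elim: c => // c IHc; rewrite ltnS leq_eqVlt => /orP[/eqP <-|ac] cD; first exact: fi.
  have := fi c cD; have := IHc ac; rewrite -!muln2 => /(_ ltac:(lia)).
  case: ifP => ak; case: ifP => ck h1 h2; rewrite -?h2 ?h1//.
    exact: lt_trans h2.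
  by lia.
move=> ab abD; have [bD|bD] := leqP b.*2 D; first exact: left.
by rewrite (fs b); [apply: left|]; lia.
Qed.

Lemma symtrap_gt0 D k f b : symtrap D k f -> (b <= D)%N -> 0 < f`_b.
Proof.
move=> fT bD; have f0 := symtrap_pos fT.
case: b => [//|b] in bD *; move: bD; rewrite leq_eqVlt => /orP[/eqP bD|bD].
  by rewrite (symtrap_sym fT) -bD// subnn.
have := @symtrap_lt D k f 0 b.+1 fT isT bD.
by case: ifP => _; [apply: lt_trans|move=> <-].
Qed.

Lemma coef_mul_qint D k f m i : symtrap D k f ->
  (f * qint R m.+1)`_i = \sum_(j < D.+1) f`_j * (j <= i <= j + m)%:R.
Proof.
move=> fT; rewrite [X in X * _](_ : f = \poly_(j < D.+1) f`_j); last first.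
  apply/polyP => j; rewrite coef_poly; case: ltnP => // jD.
  by rewrite (symtrap_big fT).
rewrite poly_def mulr_suml coef_sum; apply: eq_bigr => j _.
rewrite -scalerAl coefZ coefXnM coef_qint; congr (_ * _).
case: ltnP => //= ji; congr (nat_of_bool _)%:R; lia.
Qed.

Lemma symtrap_mul_qint D k f m : symtrap D k f ->
  exists l, symtrap (D + m) l (f * qint R m.+1).
Proof.
move=> fT; have gE i := coef_mul_qint m i fT.
have [kD fs fb f0 fi] := fT.
(* The step at [i] compares [f] at [i - m] and [i + 1]: it is strict while [i < k + m] and [i < D],
   the last bound being the middle of the product. *)
exists (minn (k + m) (minn D (D + m)./2)); split=> [|i iD|i iD||i iD].
- by lia.
- rewrite !gE (reindex_inj rev_ord_inj) /=; apply: eq_bigr => j _.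
  rewrite subSS -fs; last by have := ltn_ord j; lia.
  by congr (_ * _%:R); congr nat_of_bool; have := ltn_ord j; lia.
- rewrite gE big1// => j _; rewrite (_ : (_ <= _ <= _)%N = false) ?mulr0//.
  by have := ltn_ord j; lia.
- by rewrite coef0M coef_qint mulr1.
(* Coefficients of (1 - X) f [m+1] = f (1 - X^(m+1)). *)
have gS : (f * qint R m.+1)`_i.+1 - (f * qint R m.+1)`_i =
    f`_i.+1 - (if (i < m)%N then 0 else f`_(i - m)).
  have := subrX1 ('X : {poly R}) m.+1; rewrite -/(qint R m.+1) => qE.
  have : f * qint R m.+1 - f * qint R m.+1 * 'X = f - f * 'X^(m.+1).
    rewrite -{1}[f * _]mulr1 -mulrBr -mulrA -[1 - 'X]opprB mulrN [_ * ('X - 1)]mulrC -qE.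
    by rewrite opprB mulrBr mulr1.
  move/polyP/(_ i.+1); rewrite !coefB coefMX coefMXn /= => ->.
  by rewrite ltnS subSS.
have hi : (i < (D + m)./2)%N by lia.
rewrite !leq_min hi andbT.
rewrite -subr_gt0 gS.
have [iD'|iD'] := ltnP i D; last first.
  rewrite andbF; apply/esym/eqP; rewrite -subr_eq0 gS fb// ifT ?subr0//.
  by rewrite -muln2 in iD; lia.
rewrite andbT; have [im|im] := ltnP i m.
  by rewrite ifT ?subr0 ?(symtrap_gt0 fT)//; lia.
have := @symtrap_lt D k f (i - m) i.+1 fT.
rewrite (_ : (i - m < k)%N = (i < k + m)%N); last by lia.
rewrite -muln2 in iD => /(_ ltac:(lia) ltac:(lia)).
by case: ifP => _; [rewrite subr_gt0|move=> e;
  apply/esym/eqP; rewrite -subr_eq0 gS ltnNge im /= e subrr].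
Qed.

Lemma symtrap_size D k f : symtrap D k f -> size f = D.+1.
Proof.
move=> fT; apply/eqP; rewrite eqn_leq; apply/andP; split.
  by apply/leq_sizeP => i iD; rewrite (symtrap_big fT).
rewrite ltnNge; apply/negP => /leq_sizeP/(_ D (leqnn D))/eqP.
by rewrite gt_eqF// (symtrap_gt0 fT).
Qed.

Lemma symtrap_trapezoidal D k f : symtrap D k f -> trapezoidal f.
Proof.
move=> fT; have [kD fs fb f0 fi] := fT; rewrite -muln2 in kD.
exists D, k, (D - k)%N; split=> [||i ik|i /andP[ki iDk]|i /andP[iDk iD]].
- exact: symtrap_size fT.
- by lia.
- by have := fi i; rewrite -muln2 ik; apply; lia.
- have [iD|iD] := leqP i.+1.*2 D.
    by have := fi i iD; rewrite ltnNge ki.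
  rewrite -muln2 in iD.
  (* A step across the centre joins two mirror images; any other step on the right reflects to one
     on the left. *)
  have [e|Di] := eqVneq i (D - i.+1)%N; first by rewrite [RHS]fs; [rewrite -e|lia].
  have := fi (D - i.+1)%N; rewrite ltnNge -muln2 (_ : (k <= D - i.+1)%N); last by lia.
  move=> /(_ ltac:(lia)); rewrite -fs; last by lia.
  rewrite (_ : (D - i.+1).+1 = (D - i)%N); last by lia.
  by rewrite -fs; [move=> ->|lia].
have := fi (D - i.+1)%N; rewrite -muln2 ifT; last by lia.
move=> /(_ ltac:(lia)); rewrite -fs; last by lia.
rewrite [f`_i]fs; last by lia.
by rewrite (_ : (D - i.+1).+1 = (D - i))%N//; lia.
Qed.

Lemma symtrap_prod n (m : 'I_n -> nat) : (forall i, 0 < m i)%N ->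
  exists k, symtrap (\sum_i (m i).-1) k (\prod_i qint R (m i)).
Proof.
elim: n m => [|n IHn] m m0; first by rewrite !big_ord0; exists 0%N; exact: symtrap1.
rewrite !big_ord_recr /=.
have [k kT] := IHn (fun i => m (widen_ord (leqnSn n) i)) (fun i => m0 _).
by have := symtrap_mul_qint (m ord_max).-1 kT; rewrite prednK.
Qed.

End SymTrap.

(** * Bases as increasing maps *)

Lemma enum_incr_image r N (f : 'I_r -> 'I_N) :
  {homo f : i j / (i < j)%N} -> enum (f @: setT) = [seq f i | i <- enum 'I_r].
Proof.
move=> fi; apply: (inj_map val_inj); apply: (irr_sorted_eq ltn_trans ltnn).
- exact: sorted_enum_ord.
- rewrite -map_comp sorted_map.
  have := iota_ltn_sorted 0 r; rewrite -val_enum_ord sorted_map.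
  by apply: sub_sorted => i j; apply: fi.
apply: eq_mem_map => i; rewrite mem_enum.
by apply/imsetP/mapP => -[k _ ->]; exists k; rewrite ?mem_enum.
Qed.

(** Each set corresponds to its increasing enumeration. The ground set is ['I_N.+1] so that [ord0]
    can be the default of [nth]. *)
Lemma big_incr (V : nmodType) (r N : nat) (F : {set 'I_N.+1} -> V) :
  \sum_(B : {set 'I_N.+1} | #|B| == r) F B =
  \sum_(f : {ffun 'I_r -> 'I_N.+1} | incr f) F (f @: setT).
Proof.
pose e (B : {set 'I_N.+1}) : {ffun 'I_r -> 'I_N.+1} := [ffun i : 'I_r => nth ord0 (enum B) i].
have e_incr (B : {set 'I_N.+1}) : #|B| = r -> {homo e B : i j / (i < j)%N}.
  move=> Br i j ij; rewrite !ffunE -!(nth_map _ 0%N val) -?cardE ?Br//.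
  by apply: (sorted_ltn_nth ltn_trans) => //;
    rewrite ?inE ?size_map -?cardE ?Br ?sorted_enum_ord.
have e_im (B : {set 'I_N.+1}) : #|B| == r -> e B @: setT = B.
  move=> /eqP Br; apply/eqP; rewrite eqEcard (card_incr (e_incr _ Br)) Br leqnn andbT.
  apply/subsetP => _ /imsetP[i _ ->].
  by rewrite ffunE -mem_enum mem_nth// -cardE Br.
rewrite (reindex_onto (fun f : {ffun 'I_r -> 'I_N.+1} => f @: setT) e)//=.
apply: eq_bigl => f; apply/andP/idP => [[/eqP fr /eqP <-]|/incrP fi].
  exact/incrP/e_incr.
rewrite card_incr//; split=> //; apply/eqP/ffunP => i.
by rewrite ffunE enum_incr_image// (nth_map i) ?size_enum_ord// nth_ord_enum.
Qed.

Lemma base_mx_incr (R : realType) r N (A : 'M[R]_(r, N)) (f : 'I_r -> 'I_N) :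
  {homo f : i j / (i < j)%N} -> base_mx A (f @: setT) = colsub f A.
Proof.
move=> fi; apply/matrixP => i k; rewrite !mxE enum_incr_image// -map_comp.
by rewrite (nth_map k) ?size_enum_ord// nth_ord_enum.
Qed.

(** * The intervals cut off by an increasing map *)

Section Blocks.
Variables (d n : nat) (g : 'I_d -> 'I_n).

(** The cut [g c] falls between columns [g c] and [g c + 1], so the label of [j] is the number of
    cuts to its left, at most [d]. *)
Definition block (j : 'I_n.+1) : 'I_d.+1 := inord #|[set c | (g c < j)%N]|.

Lemma blockK j : block j = #|[set c | (g c < j)%N]| :> nat.
Proof. by rewrite inordK// ltnS -[leqRHS](card_ord d) max_card. Qed.

Lemma block_homo : {homo block : i j / (i <= j)%N}.
Proof.
move=> i j ij; rewrite !blockK subset_leq_card//; apply/subsetP => c.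
by rewrite !inE => /leq_trans; apply.
Qed.

Hypothesis g_incr : {homo g : i j / (i < j)%N}.

(** The cuts to the left of [j] form an initial segment of ['I_d], so their number determines which
    they are. *)
Lemma ltn_block (c : 'I_d) j : (c < block j)%N = (g c < j)%N.
Proof.
rewrite blockK; have cardlt (k : 'I_d) : #|[set i : 'I_d | (i < k)%N]| = k.
  rewrite -sum1dep_card -(big_ord_widen _ (fun=> 1%N) (ltnW (ltn_ord k))).
  by rewrite sum1_card card_ord.
case: (ltnP (g c) j) => [gcj|jgc]; last first.
  apply/negbTE; rewrite -leqNgt -[leqRHS]cardlt; apply/subset_leq_card/subsetP => k.
  rewrite !inE => gkj; rewrite ltnNge; apply/negP => /(incr_leq g_incr).
  by move=> /(leq_trans jgc); rewrite leqNgt gkj.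
rewrite -[ltnLHS]cardlt; apply: proper_card; apply/properP; split; last first.
  by exists c; rewrite !inE ?ltnn.
apply/subsetP => k; rewrite !inE => /ltnW/(incr_leq g_incr) gk.
exact: leq_ltn_trans gk gcj.
Qed.

Lemma block_eqP (i : 'I_d.+1) (j : 'I_n.+1) :
  reflect (forall c : 'I_d, (c < i)%N = (g c < j)%N) (block j == i).
Proof.
apply: (iffP eqP) => [<- c|H]; first exact: ltn_block.
apply/val_inj => /=; have [lt|lt|//] := ltngtP (block j) i.
  have id : (block j < d)%N by rewrite (leq_trans lt)// -ltnS.
  by have := H (Ordinal id); rewrite -ltn_block /= lt ltnn.
have id : (i < d)%N by rewrite (leq_trans lt)// -ltnS.
by have := H (Ordinal id); rewrite -ltn_block /= lt ltnn.
Qed.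

Lemma fibre_block_gt0 i : (0 < fibre block i)%N.
Proof.
apply/card_gt0P; case: (unliftP ord_max i) => [c ->|->].
  (* Interval [c] contains its right end [g c]; the last interval contains [ord_max]. *)
  exists (lift ord_max (g c)); rewrite inE; apply/block_eqP => k.
  rewrite !lift_max; apply/idP/idP => [/g_incr//|]; apply: contraLR.
  by rewrite -!leqNgt => /(incr_leq g_incr).
by exists ord_max; rewrite inE; apply/block_eqP => k; rewrite /= !ltn_ord.
Qed.

End Blocks.

(** Interlacing bounds each [f i] by the cuts around interval [i]. Conversely, for [i < j] a section
    satisfies f(i) <= g(i) < f(j), hence is increasing. *)
Lemma interlace_section d n (f : 'I_d.+1 -> 'I_n.+1) (g : 'I_d -> 'I_n) : incr g ->
  incr f && [forall c : 'I_d, f (lift ord_max c) <= g c < f (lift ord0 c)]%N =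
  is_section (block g) f.
Proof.
move=> /incrP gi; apply/andP/forallP => [[/incrP fi /forallP fg] i|fs].
  apply/(block_eqP gi) => c; have /andP[fg1 fg2] := fg c.
  apply/idP/idP => [ci|]; first by apply: leq_trans fg2 _; apply: incr_leq.
  apply: contraLR; rewrite -!leqNgt => ic; apply: leq_trans fg1.
  by apply: incr_leq => //; rewrite lift_max.
have fsP i c := block_eqP gi _ _ (fs i) c.
have fg : [forall c : 'I_d, f (lift ord_max c) <= g c < f (lift ord0 c)]%N.
  by apply/forallP => c; rewrite leqNgt -!fsP lift_max ltnn /=.
split=> //; apply/incrP => i j ij.
have id : (i < d)%N by rewrite (leq_trans ij)// -ltnS.
apply: (@leq_ltn_trans (g (Ordinal id))); last by rewrite -fsP.
by rewrite leqNgt -fsP /= ltnn.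
Qed.

Lemma sum_fibre r N (lab : 'I_N -> 'I_r) : (\sum_i fibre lab i)%N = N.
Proof.
rewrite -[RHS](card_ord N) -sum1_card (partition_big lab predT)//=.
by apply: eq_bigr => i _; rewrite /fibre -sum1_card; apply: eq_bigl => j; rewrite inE.
Qed.

Lemma solid_pos_tp (R : realType) d N (A : 'M[R]_(d, N)) : totally_positive A -> solid_pos A.
Proof.
move=> Atp s p c pi csolid; apply: Atp => // i j ij.
by have := csolid i j; lia.
Qed.

(** * The box expansion of the polynomial and its consequences *)

Lemma f_polyE (R : realType) d n (A : 'M[R]_(d.+1, n.+1)) (rho : 'cV[R]_n.+1) :
  totally_positive A -> (forall j, A ord_max j = 1) -> generic A rho ->
  f_poly A rho = \sum_(g : {ffun 'I_d -> 'I_n} | incr g)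
    \det (colsub g (diffcol A)) *: \prod_i qint R (fibre (block g) i).
Proof.
move=> Atp A1 gen; rewrite /f_poly.
under eq_bigl => B do rewrite is_baseE//.
rewrite big_incr.
transitivity (\sum_(f : {ffun 'I_d.+1 -> 'I_n.+1} | incr f)
   \sum_(g : {ffun 'I_d -> 'I_n} |
      [forall c : 'I_d, f (lift ord_max c) <= g c < f (lift ord0 c)]%N)
     \det (colsub g (diffcol A)) *: 'X^#|[set j | 0 < height A rho f j]| : {poly R}).
  apply: eq_bigr => f /incrP fi; rewrite ext_activityE// base_mx_incr//.
  rewrite gtr0_norm ?det_colsub_interlace ?scaler_suml//.
  by rewrite -det_colsub_interlace// solid_pos_det//; apply: solid_pos_tp.
(* Any [g] interlacing an increasing [f] is increasing, so the new outer sum may be restricted to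
   such [g]. *)
rewrite (exchange_big_dep (fun g : {ffun 'I_d -> 'I_n} => incr g))/=; last first.
  by move=> f g /incrP fi fg; apply/incrP; apply: incr_interlace fg.
apply: eq_bigr => g gi; rewrite -scaler_sumr; congr (_ *: _).
rewrite -(sum_sections Atp gen (@block_homo _ _ g)).
by apply: eq_bigl => f; rewrite interlace_section.
Qed.

Lemma symtrap_sum (R : realType) (T : eqType) (s : seq T) (F : T -> {poly R}) D :
  s != [::] -> (forall t, t \in s -> exists k, symtrap D k (F t)) ->
  exists k, symtrap D k (\sum_(t <- s) F t).
Proof.
elim: s => // t [|u s] IHs _ sT.
  by rewrite big_seq1; apply: sT; rewrite mem_head.
have [k kT] := sT t (mem_head _ _).
have [//|v vs|l lT] := IHs _; first by apply: sT; rewrite inE vs orbT.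
by rewrite big_cons; exists (maxn k l); apply: symtrapD.
Qed.

Theorem theorem3 (R : realType) (d N : nat) (A : 'M[R]_(d.+1, N))
    (hdN : (d.+1 <= N)%N)
    (hA : totally_positive A)
    (hlast : forall j : 'I_N, A ord_max j = 1)
    (rho : 'cV[R]_N) (hrho : generic A rho) :
  box_positive (f_poly A rho) /\ trapezoidal (f_poly A rho).
Proof.
case: N => [//|n] in A hdN hA hlast rho hrho *.
rewrite ltnS in hdN.
(* The [d + 1] interval sizes sum to [n + 1 = D + (d + 1)]. *)
pose D := (n - d)%N.
pose box (g : {ffun 'I_d -> 'I_n}) :=
  (\det (colsub g (diffcol A)), [tuple fibre (block g) i | i < d.+1]).
pose s := [seq box g | g <- enum (fun g : {ffun 'I_d -> 'I_n} => incr g)].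
have fE : f_poly A rho = \sum_(t <- s) t.1 *: \prod_(i < d.+1) qint R (tnth t.2 i).
  rewrite f_polyE// big_map big_enum; apply: eq_bigr => g _.
  by congr (_ *: _); apply: eq_bigr => i _; rewrite tnth_mktuple.
have sP t : t \in s -> [/\ 0 < t.1, forall i, (0 < tnth t.2 i)%N
     & (\sum_(i < d.+1) tnth t.2 i)%N = (D + d.+1)%N].
  move=> /mapP[g]; rewrite mem_enum => gi ->; have gi' := incrP _ gi.
  split=> [|i|] /=.
  - apply: solid_pos_det => //; apply: solid_pos_diffcol => //.
    exact: solid_pos_tp.
  - by rewrite tnth_mktuple fibre_block_gt0.
  under eq_bigr do rewrite tnth_mktuple.
  by rewrite sum_fibre; lia.
have [k fT] : exists k, symtrap D k (f_poly A rho).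
  rewrite fE; apply: symtrap_sum => [|t /sP[t0 tpos tsum]].
    rewrite -size_eq0 size_map -cardE -lt0n; apply/card_gt0P.
    (* The inclusion of the first [d] indices shows that the expansion has at least one term. *)
    exists [ffun c => widen_ord hdN c]; apply/incrP => i j ij.
    by rewrite !ffunE.
  have [k kT] := symtrap_prod R tpos; exists k; apply: symtrapZ => //.
  congr symtrap : kT; apply/eqP; rewrite -(eqn_add2r d.+1) -tsum.
  rewrite -[X in (_ + X == _)%N](card_ord d.+1) -sum1_card -big_split /=.
  by apply/eqP/eq_bigr => i _; rewrite addn1 prednK.
split; last exact: symtrap_trapezoidal fT.
by exists d.+1, D, s; split=> //; apply: symtrap_size fT.
Qed.
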